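(* For $a\in\mathbb{C}$ and $n\in\mathbb{Z}_+$, the level $n$ Zhu algebra $A_n(M_a(1))$ of the rank one Heisenberg vertex operator algebra $M_a(1)$ is generated by the elements \[ \alpha(-2n)^{i_{2n}}\alpha(-2n+1)^{i_{2n-1}}\cdots\alpha(-1)^{i_1}\mathbf{1}+O_n(M_a(1))\quad\text{and}\quad \alpha(-1)^j\mathbf{1}+O_n(M_a(1)), \] where $i_1,\dots,i_{2n}\in\mathbb{N}$ with $0\le i_1\le n$, and $j\in\mathbb{Z}_+$.
   Context: Let $\mathfrak{h}=\mathbb{C}\alpha$ with $\langle\alpha,\alpha\rangle=1$, and $\hat{\mathfrak{h}}=\mathfrak{h}\otimes\mathbb{C}[t,t^{-1}]\oplus\mathbb{C}\mathbf{k}$ with $[\alpha(m),\alpha(p)]=m\delta_{m+p,0}\mathbf{k}$, $\mathbf{k}$ central, $\alpha(m)=\alpha\otimes t^m$. $M(1)=U(\hat{\mathfrak{h}})\otimes_{U(\mathfrak{h}\otimes\mathbb{C}[t]\oplus\mathbb{C}\mathbf{k})}\mathbb{C}\mathbf{1}$ where $\mathfrak{h}\otimes\mathbb{C}[t]$ acts trivially and $\mathbf{k}$ as $1$; it is a vertex operator algebra with $Y(\alpha(-1)\mathbf{1},x)=\sum_m\alpha(m)x^{-m-1}$, spanned by $\alpha(-k_1)\cdots\alpha(-k_j)\mathbf{1}$. $M_a(1)$ is this vertex algebra with conformal vector $\omega_a=\frac12\alpha(-1)^2\mathbf{1}+a\alpha(-2)\mathbf{1}$ (central charge $1-12a^2$);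 $\alpha(-1)\mathbf{1}$ has weight $1$. For a vertex operator algebra $V$, $n\in\mathbb{N}$, homogeneous $u$: $u\circ_nv=\mathrm{Res}_x(1+x)^{\mathrm{wt}\,u+n}Y(u,x)v\,x^{-2n-2}$, $O_n(V)=\{(L(-1)+L(0))v\}+\mathrm{span}\{u\circ_nv\}$, $A_n(V)=V/O_n(V)$ with product $u*_nv=\sum_{m=0}^n(-1)^m\binom{m+n}{n}\mathrm{Res}_x(1+x)^{\mathrm{wt}\,u+n}Y(u,x)v\,x^{-n-m-1}$. *)

(* Defs.v *)
From HB Require Import structures.
From mathcomp Require Import all_boot all_order all_algebra.
From mathcomp Require Import reals finmap.
From mathcomp.real_closed Require Export complex.
From mathcomp.multinomials Require Export monalg.

Set Implicit Arguments.
Unset Strict Implicit.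
Unset Printing Implicit Defensive.

Import Order.TTheory GRing.Theory Num.Theory.
Local Open Scope ring_scope.

(* Basis of M(1): partitions.  The monomial                             *)
(*   alpha(-k_1) ... alpha(-k_j) 1   (k_i >= 1)                          *)
(* is indexed by the nondecreasing list [k_1; ...; k_j] of its parts.    *)
(* Since the alpha(-k), k >= 1, commute, these monomials form a basis   *)
(* of M(1) (PBW), and M(1) is the free vector space on partitions.       *)

Definition is_part (s : seq nat) : bool :=
  sorted leq s && all (fun k => 0 < k)%N s.

Definition Part := {s : seq nat | is_part s}.

Definition empty_part : Part := exist _ [::] erefl.

Definition mkPart (s : seq nat) : Part :=
  insubd empty_part (sort leq [seq k <- s | (0 < k)%N]).

Definition pwt (p : Part) : nat := sumn (val p).

Section Heisenberg.
Variable F : fieldType.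

Definition V := {malg F[Part]}.

Definition bvec (s : seq nat) : V := << mkPart s >>.

Definition vac : V := bvec [::].

Definition lin (f : Part -> V) (v : V) : V :=
  \sum_(p <- msupp v) v@_p *: f p.

(* alpha(m) on basis vectors:
   alpha(-k) (k>0) multiplies by alpha(-k);
   alpha(0) = 0 on M(1);
   alpha(k) (k>0) acts as k d/d alpha(-k), from [alpha(k),alpha(-k)] = k. *)
Definition alphaB (m : int) (p : Part) : V :=
  match m with
  | Posz 0 => 0
  | Posz k => (k * count_mem k (val p))%:R *: bvec (rem k (val p))
  | Negz k => bvec (k.+1 :: val p)
  end.

Definition alpha (m : int) (v : V) : V := lin (alphaB m) v.

Definition maxwt (v : V) : nat := (\max_(p <- msupp v) pwt p)%N.

(* modes u_(q) of the vertex operator Y(u,x) = sum_q u_(q) x^(-q-1) of M(1),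
   for u = alpha(-k_1) ... alpha(-k_j) 1 given by its list of parts w.
   Defined by recursion on w via the iterate (associativity) formula, with
   a = alpha(-1)1, a_(m) = alpha(m), u = a_(-k) w':
     (a_(-k) w')_(q) = sum_(i>=0) (-1)^i binom(-k,i)
              [ alpha(-k-i) w'_(q+i) - (-1)^k w'_(q-k-i) alpha(i) ],
   and 1_(q) = delta_(q,-1) id.  Note (-1)^i binom(-k,i) = binom(k+i-1,i).
   The sum over i is finite when applied to v: the terms with
   i > sumn w + maxwt v + |q| vanish (weight reasons), so the truncation
   below is exact. *)
Fixpoint modeB (w : seq nat) (q : int) (v : V) : V :=
  match w with
  | [::] => if q == -1 then v else 0
  | k :: w' =>
      \sum_(i < (sumn w + maxwt v + `|q|).+1)
        ('C(k + i - 1, i))%:R *: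
          (alpha (- (k + i)%:Z) (modeB w' (q + i%:Z) v)
           - (-1) ^+ k *: modeB w' (q - k%:Z - i%:Z) (alpha i%:Z v))
  end.

Definition modeP (u : Part) (q : int) (v : V) : V := modeB (val u) q v.

Definition mode (u : V) (q : int) (v : V) : V :=
  \sum_(p <- msupp u) u@_p *: modeP p q v.

Definition omega (a : F) : V := 2%:R^-1 *: bvec [:: 1%N; 1%N] + a *: bvec [:: 2%N].

Definition Lop (a : F) (m : int) (v : V) : V := mode (omega a) (m + 1) v.

(* u o_n v = Res_x (1+x)^(wt u + n) Y(u,x) v x^(-2n-2)
           = sum_(j=0)^(wt u + n) binom(wt u + n, j) u_(j-2n-2) v,
   for homogeneous (basis) u, of weight pwt u. *)
Definition circ (n : nat) (u : Part) (v : V) : V :=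
  \sum_(j < (pwt u + n).+1)
     ('C(pwt u + n, j))%:R *: modeP u (j%:Z - (2 * n)%:Z - 2) v.

Inductive On (a : F) (n : nat) : V -> Prop :=
  | On_L v : On a n (Lop a (-1) v + Lop a 0 v)
  | On_circ (u : Part) (v : V) : On a n (circ n u v)
  | On_zero : On a n 0
  | On_add x y : On a n x -> On a n y -> On a n (x + y)
  | On_scale (c : F) x : On a n x -> On a n (c *: x).

(* u *_n v = sum_(m=0)^n (-1)^m binom(m+n,n)
              Res_x (1+x)^(wt u + n) Y(u,x) v x^(-n-m-1)
           = sum_m (-1)^m binom(m+n,n) sum_(j=0)^(wt u+n)
                  binom(wt u+n, j) u_(j-n-m-1) v,
   for homogeneous (basis) u, extended linearly in u. *)
Definition starP (n : nat) (u : Part) (v : V) : V :=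
  \sum_(m < n.+1)
    ((-1) ^+ m * ('C(m + n, n))%:R) *:
      \sum_(j < (pwt u + n).+1)
         ('C(pwt u + n, j))%:R *: modeP u (j%:Z - n%:Z - m%:Z - 1) v.

Definition star (n : nat) (u v : V) : V :=
  \sum_(p <- msupp u) u@_p *: starP n p v.

(* the subalgebra of (M_a(1), *_n) generated by a set S of vectors;
   its image in A_n = M_a(1)/O_n is the subalgebra of A_n generated by
   the classes of the elements of S. *)
Inductive gen_by (n : nat) (S : V -> Prop) : V -> Prop :=
  | gen_base x : S x -> gen_by n S x
  | gen_zero : gen_by n S 0
  | gen_add x y : gen_by n S x -> gen_by n S y -> gen_by n S (x + y)
  | gen_scale (c : F) x : gen_by n S x -> gen_by n S (c *: x)
  | gen_mul x y : gen_by n S x -> gen_by n S y -> gen_by n S (star n x y).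

(* A_n(M_a(1)) is generated (as an algebra) by the classes of the elements
   of S: every class v + O_n contains an element of the subalgebra
   generated by S. *)
Definition zhu_generated (a : F) (n : nat) (S : V -> Prop) : Prop :=
  forall v : V, exists2 g, gen_by n S g & On a n (v - g).

Definition monom (N : nat) (i : nat -> nat) : V :=
  bvec (flatten [seq nseq (i k) k | k <- iota 1 N]).

End Heisenberg.

(* Main.v *)
Require Import Defs.
From HB Require Import structures.
From mathcomp Require Import all_boot all_order all_algebra.
From mathcomp Require Import reals.
From mathcomp.real_closed Require Import complex.
From mathcomp.multinomials Require Import monalg.
From mathcomp Require Import finmap ring zify.

(* Filter M(1) by the number of factors alpha(-k).  To leading order Y(u, x) v
   is the commutative product (e^(xT) u) v, so everything reduces to commuting
   operators X_k = alpha(-k).  Identify the linear forms in the X_k with F[z]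
   through X_k = binom(z - 1, k - 1); then z is the derivation L(-1) + L(0),
   and (1 + x)^L(0) e^(x L(-1)) is multiplication by (1 + x)^z.

   Write L(f) for the form attached to f.  Modulo O_n and shorter monomials:
   - u = L(f) 1 gives L(P g) v = 0 for P = binom(z + n, 2n + 1), whose roots are
     -n, ..., n; so alpha(-k), k > 2n + 1, is expressed by the others;
   - alpha *_n v = L(S) v where S has degree 2n, so alpha(-2n-1) can be traded
     for alpha(-1) *_n _, and S(1) = 0;
   - for Q = P / (z - 1) the form L(Q) is an eigenvector of z of eigenvalue 1,
     whence u = L(Q)^(n+1) 1 gives u o_n v = L(Q)^(n+1) v = 0.
   As Q(1) <> 0 and S(1) = 0, L(Q) is a nonzero multiple of alpha(-1) plus forms
   in L(S) and alpha(-2), ..., alpha(-2n), so the last relation lowers the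
   exponent of alpha(-1) until it is at most n. *)

Set Implicit Arguments.
Unset Strict Implicit.
Unset Printing Implicit Defensive.

Import Order.TTheory GRing.Theory Num.Theory.
Local Open Scope ring_scope.

(** * Linear subspaces *)

Section Subspaces.
Variables (F : fieldType) (U : lmodType F).

Definition subspace (K : U -> Prop) : Prop :=
  [/\ K 0, forall x y, K x -> K y -> K (x + y) & forall c x, K x -> K (c *: x)].

Lemma subspace_sum (K : U -> Prop) (I : Type) (r : seq I) (P : pred I)
    (f : I -> U) :
  subspace K -> (forall i, P i -> K (f i)) -> K (\sum_(i <- r | P i) f i).
Proof. by case=> K0 KD _ Kf; elim/big_rec: _ => // i x Pi; apply: KD; apply: Kf. Qed.

Lemma eq_sum_scale (I : Type) (r : seq I) (c : I -> F) (x y : I -> U) :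
  (forall i, x i = y i) -> \sum_(i <- r) c i *: x i = \sum_(i <- r) c i *: y i.
Proof. by move=> xy; apply: eq_bigr => i _; rewrite xy. Qed.

Lemma subspaceB (K : U -> Prop) x y : subspace K -> K x -> K y -> K (x - y).
Proof. by case=> K0 KD KZ Kx Ky; apply: KD => //; rewrite -scaleN1r; apply: KZ. Qed.

Lemma subspace_sumZB (K : U -> Prop) (I : Type) (r : seq I) (c : I -> F)
    (x y : I -> U) : subspace K -> (forall i, K (x i - y i)) ->
  K (\sum_(i <- r) c i *: x i - \sum_(i <- r) c i *: y i).
Proof.
move=> sK Kxy; rewrite -sumrB; apply: subspace_sum => // i _.
by rewrite -scalerBr; case: sK => _ _; apply.
Qed.

Lemma subspaceBAC (K : U -> Prop) x y z :
  subspace K -> K (x - z) -> K y -> K (x - y - z).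
Proof. by move=> sK Kxz Ky; rewrite addrAC; apply: subspaceB. Qed.

Lemma subspace_subr (K : U -> Prop) x y : subspace K -> K (x - y) -> K y -> K x.
Proof. by case=> K0 KD KZ Kxy Ky; rewrite -(subrK y x); apply: KD. Qed.

End Subspaces.

Lemma subspace_preim (F : fieldType) (U U' : lmodType F) (g : {linear U' -> U}) (K : U -> Prop) :
  subspace K -> subspace (fun v : U' => K (g v)).
Proof.
case=> K0 KD KZ; split=> [|x y Kx Ky|c x Kx].
- by rewrite linear0.
- by rewrite linearD; exact: KD.
- by rewrite linearZ; exact: KZ.
Qed.
Lemma subspace_eq (F : fieldType) (U U' : lmodType F) (g h : {linear U' -> U}) :
  subspace (fun v : U' => g v = h v).
Proof.
split=> [|x y gx gy|c x gx].
- by rewrite !linear0.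
- by rewrite !linearD gx gy.
- by rewrite !linearZ gx.
Qed.

(** * The Fock space and its length filtration *)

(* Sealed copies of bvec and alpha: unfolding these down to finitely supported
   functions makes unification intractable. *)
HB.lock Definition basis (F : fieldType) (s : seq nat) : V F := bvec F s.
HB.lock Definition X (F : fieldType) (k : nat) (v : V F) : V F := alpha (Negz k) v.

Section Fock.
Variable F : fieldType.
Local Notation V := (V F).
Local Notation bvec := (basis F).
Local Notation X := (@X F).
Implicit Types (u v w x y : V) (s t : seq nat) (f : Part -> V).

Lemma basisE s : bvec s = Defs.bvec F s.
Proof. by rewrite basis.unlock. Qed.

Definition positive s := all (fun k => 0 < k)%N s.

Lemma val_mkPart s : positive s -> val (mkPart s) = sort leq s.
Proof.
move=> pos_s; rewrite /mkPart insubdK.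
  by congr sort; apply/all_filterP.
rewrite unfold_in /is_part sort_sorted; last exact: leq_total.
by rewrite all_sort filter_all.
Qed.

Lemma perm_val_mkPart s : positive s -> perm_eq (val (mkPart s)) s.
Proof. by move=> /val_mkPart ->; rewrite perm_sort. Qed.

Lemma eq_bvec s t : perm_eq s t -> bvec s = bvec t.
Proof.
move=> st; rewrite basis.unlock /Defs.bvec /mkPart; congr (<< insubd _ _ >>).
apply/perm_sortP; first exact: leq_total.
- exact: leq_trans.
- exact: anti_leq.
by apply/permP => a; rewrite !count_filter; apply/permP.
Qed.

Lemma positive_val (p : Part) : positive (val p).
Proof. by have /andP[] := valP p. Qed.

Lemma bvec_val (p : Part) : << p >> = bvec (val p).
Proof.
rewrite basis.unlock; congr (<< _ >>); apply: val_inj; rewrite val_mkPart ?positive_val//.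
apply/esym/sorted_sort; first exact: leq_trans.
by have /andP[] := valP p.
Qed.

Lemma linEw f (d : {fset Part}) v : (msupp v `<=` d)%fset ->
  lin f v = \sum_(p <- d) v@_p *: f p.
Proof.
move=> vd; rewrite /lin (big_fset_incl _ vd)// => p _ pv.
by rewrite mcoeff_outdom ?scale0r.
Qed.

Lemma lin_is_linear f : linear (lin f).
Proof.
move=> c x y; set d := (msupp x `|` msupp y `|` msupp (c *: x + y))%fset.
have dx : (msupp x `<=` d)%fset by rewrite /d -fsetUA fsubsetUl.
have dy : (msupp y `<=` d)%fset by rewrite /d fsetUC fsetUA fsubsetUr.
have dxy : (msupp (c *: x + y) `<=` d)%fset by rewrite fsubsetUr.
rewrite (linEw _ dx) (linEw _ dy) (linEw _ dxy) scaler_sumr -big_split /=.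
by apply: eq_bigr => p _; rewrite mcoeffD mcoeffZ scalerDl scalerA.
Qed.

HB.instance Definition _ f :=
  GRing.isLinear.Build F V V _ (lin f) (lin_is_linear f).

Lemma lin_part f p : lin f << p >> = f p.
Proof. by rewrite /lin msuppU oner_eq0 big_seq_fset1 mcoeffUU scale1r. Qed.

Lemma vect_sum v : v = \sum_(p <- msupp v) v@_p *: bvec (val p).
Proof.
rewrite {1}(monalgE v); apply: eq_bigr => p _; rewrite -bvec_val.
by apply/malgP => q; rewrite mcoeffU mcoeffZ mcoeffU mulrnAr mulr1.
Qed.

Lemma vect_ind (K : V -> Prop) v : subspace K ->
  (forall p, p \in msupp v -> K (bvec (val p))) -> K v.
Proof.
move=> subK Kv; rewrite (vect_sum v) big_seq.
by apply: (subspace_sum _ subK) => p /Kv Kp; case: subK => _ _; apply.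
Qed.

HB.instance Definition _ m :=
  GRing.isLinear.Build F V V _ (@alpha F m) (lin_is_linear (@alphaB F m)).

Lemma X_is_linear k : linear (X k).
Proof. by rewrite X.unlock; exact: lin_is_linear. Qed.

HB.instance Definition _ k :=
  GRing.isLinear.Build F V V _ (X k) (X_is_linear k).

Lemma alpha_bvec m s : alpha m (bvec s) = alphaB F m (mkPart s).
Proof. by rewrite basis.unlock; exact: lin_part. Qed.

Lemma X_bvec k s : positive s -> X k (bvec s) = bvec (k.+1 :: s).
Proof.
move=> pos_s; rewrite X.unlock alpha_bvec /= -basisE.
by apply: eq_bvec; rewrite perm_cons perm_val_mkPart.
Qed.

Lemma X_comm j k v : X j (X k v) = X k (X j v).
Proof.
apply: (vect_ind (subspace_eq (X j \o X k) (X k \o X j))).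
move=> p _; have pos_p := positive_val p.
rewrite /= !X_bvec//; apply: eq_bvec.
by rewrite -[_ :: _ :: _]/([:: _] ++ [:: _] ++ _) perm_catCA.
Qed.

(** The bound is strict, so that [shorter 0] is the zero space, where the final induction on length
    starts. *)
Definition shorter d v : Prop := forall p, p \in msupp v -> (size (val p) < d)%N.

Lemma shorter_subspace d : subspace (shorter d).
Proof.
split=> [p|x y Fx Fy p|c x Fx p]; first by rewrite msupp0.
  by move=> /(fsubsetP (msuppD_le _ _)); rewrite in_fsetU => /orP[/Fx|/Fy].
by move=> /(fsubsetP (msuppZ_le _ _)) /Fx.
Qed.

Lemma shorter_le d e v : (d <= e)%N -> shorter d v -> shorter e v.
Proof. by move=> de Fv p /Fv /leq_trans; apply. Qed.

Lemma shorter_zero v : shorter 0 v -> v = 0.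
Proof.
by move=> Fv; rewrite (vect_sum v) big_seq big1 // => p /Fv.
Qed.

Lemma shorter_bvec d s : positive s -> (size s < d)%N -> shorter d (bvec s).
Proof.
move=> pos_s sd p; rewrite basis.unlock /Defs.bvec msuppU oner_eq0 in_fset1 => /eqP ->.
by rewrite val_mkPart// size_sort.
Qed.

Lemma shorter_ind d (K : V -> Prop) v : subspace K ->
  (forall s, positive s -> (size s < d)%N -> K (bvec s)) -> shorter d v -> K v.
Proof.
move=> subK Ks Fv; apply: vect_ind => // p pv.
by apply: Ks (Fv _ pv); exact: positive_val.
Qed.

Lemma shorter_X d k v : shorter d v -> shorter d.+1 (X k v).
Proof.
apply: (@shorter_ind d (fun v => shorter d.+1 (X k v))).
  exact: subspace_preim (shorter_subspace _).
by move=> s pos_s sd; rewrite X_bvec//; apply: shorter_bvec.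
Qed.

(** For i > 0, alpha(i) removes one part i from a monomial, or kills it if there is none; alpha(0)
    is zero on M(1). *)
Lemma shorter_annihilation d (i : nat) v : shorter d v -> shorter d.-1 (alpha i%:Z v).
Proof.
apply: (@shorter_ind d (fun v => shorter d.-1 (alpha i%:Z v))).
  exact: subspace_preim (shorter_subspace _).
move=> s pos_s sd; rewrite alpha_bvec.
rewrite /alphaB val_mkPart// -?basisE.
have [F0 _ FZ] := shorter_subspace d.-1.
case: i => [|i]; first exact: F0.
have [iM|iM] := boolP (i.+1 \in sort leq s); last first.
  by rewrite (count_memPn iM) muln0 scale0r; exact: F0.
apply/FZ/shorter_bvec.
  apply/allP => k /mem_rem; rewrite mem_sort; exact: (allP pos_s).
rewrite size_rem// size_sort.
rewrite mem_sort in iM; have : (0 < size s)%N by case: (s) iM.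
by case: d sd {F0 FZ} => //= d; case: (size s).
Qed.

End Fock.

(** * Binomial polynomials *)

(** For [k + i <= m] both sides are m! / (k! i! (m - k - i)!); otherwise both vanish. *)
Lemma mul_bin_trinomial m k i : (k <= m)%N ->
  ('C(k + i, i) * 'C(m, k + i) = 'C(m, k) * 'C(m - k, i))%N.
Proof.
move=> km; have [kim|kim] := leqP (k + i) m; last first.
  by rewrite (@bin_small m)// (@bin_small (m - k)) ?muln0//; lia.
have := bin_fact kim; have := bin_fact km.
have im : (i <= m - k)%N by lia.
have := bin_fact im; have := @bin_fact (k + i) i (leq_addl _ _).
rewrite addnK subnDA => E1 E2 E3 E4.
have f1 := fact_gt0 k; have f2 := fact_gt0 i; have f3 := fact_gt0 (m - k - i).
have f4 := fact_gt0 (k + i); have f5 := fact_gt0 (m - k).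
apply/eqP; rewrite -(eqn_pmul2r (m := k`! * i`! * (m - k - i)`!)) ?muln_gt0 ?f1 ?f2//.
apply/eqP; transitivity (m`!).
  by rewrite -[RHS]E4 -E1; ring.
by rewrite -[LHS]E3 -E2; ring.
Qed.

Section BinomialPolynomials.
Variable F : numFieldType.
Implicit Types (f g p q c : {poly F}).

Lemma poly_eq_on_nat p q : (forall m, p.[m.+1%:R] = q.[m.+1%:R]) -> p = q.
Proof.
move=> pq; apply/eqP; rewrite -subr_eq0; apply/negPn/negP => nz.
have : (size [seq m.+1%:R : F | m <- iota 0 (size (p - q)%R)] < size (p - q)%R)%N.
  apply: max_poly_roots => //.
    by apply/allP => _ /mapP[m _ ->]; rewrite /root hornerD hornerN pq subrr.
  rewrite map_inj_uniq ?iota_uniq// => i j /eqP; rewrite eqr_nat => /eqP.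
  by case.
by rewrite size_map size_iota ltnn.
Qed.

Definition binp l : {poly F} := l`!%:R^-1 *: \prod_(i < l) ('X - i%:R%:P).

Lemma horner_binp l (m : nat) : (binp l).[m%:R] = 'C(m, l)%:R.
Proof.
rewrite hornerZ horner_prod.
have -> : \prod_(i < l) ('X - i%:R%:P).[m%:R] = (m ^_ l)%:R :> F.
  elim: l => [|l IH]; first by rewrite big_ord0 ffactn0.
  rewrite big_ord_recr/= IH !hornerE ffactnSr natrM.
  have [lm|ml] := leqP l m; first by rewrite natrB.
  by rewrite ffact_small// !mul0r.
rewrite -bin_ffact natrM mulrC mulfK// pnatr_eq0.
by rewrite -lt0n fact_gt0.
Qed.

Lemma size_prod_XsubC_ord l (h : 'I_l -> F) : size (\prod_(i < l) ('X - (h i)%:P)) = l.+1.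
Proof.
by rewrite size_prod_XsubC [index_enum _]unlock -enumT size_enum_ord.
Qed.

Lemma size_binp l : size (binp l) = l.+1.
Proof.
rewrite size_scale; first exact: size_prod_XsubC_ord.
by rewrite invr_eq0 pnatr_eq0 -lt0n fact_gt0.
Qed.

Definition pshift (N : F) p : {poly F} := p \Po ('X + N%:P).

Lemma size_pshift N p : size (pshift N p) = size p.
Proof. by rewrite size_comp_poly2// size_XaddC. Qed.

Lemma horner_pshift N p x : (pshift N p).[x] = p.[x + N].
Proof. by rewrite horner_comp !hornerE. Qed.

(** Coefficient of x^J in (1 + x)^N (1 + x)^z = (1 + x)^(N + z). *)
Lemma binp_vandermonde N J :
  \sum_(l < J.+1) 'C(N, J - l)%:R *: binp l = pshift N%:R (binp J).
Proof.
apply: poly_eq_on_nat => m; rewrite horner_pshift -natrD horner_binp -binomial.Vandermonde.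
rewrite horner_sum natr_sum; apply: eq_bigr => i _.
by rewrite hornerZ horner_binp mulrC natrM.
Qed.

(* [e k] is binom(z - 1, k); it represents alpha(-k-1). *)
Definition e k : {poly F} := pshift (-1) (binp k).

Lemma size_e k : size (e k) = k.+1.
Proof. by rewrite size_pshift size_binp. Qed.

Lemma horner_e k m : (e k).[m.+1%:R] = 'C(m, k)%:R.
Proof. by rewrite horner_pshift -natr1 addrK horner_binp. Qed.

Lemma e0 : e 0 = 1.
Proof. by apply: poly_eq_on_nat => m; rewrite horner_e bin0 hornerE. Qed.

(** This is the action of L(-1) + L(0): alpha(-k-1) has weight k + 1, and L(-1) sends it to (k + 1)
    alpha(-k-2). *)
Lemma mulX_e k : 'X * e k = k.+1%:R *: (e k + e k.+1).
Proof.
apply: poly_eq_on_nat => m; rewrite hornerZ hornerD !horner_e hornerM hornerX horner_e.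
by rewrite -natrD -!natrM addnC -binS mul_bin_diag.
Qed.

(** Coefficient of x^l in (1 + x)^z alpha(-k-1): the weight factor (1 + x)^(k+1) times the
    translation series sum_i binom(k + i, i) x^i alpha(-k-1-i). *)
Lemma binp_mul_e l k :
  binp l * e k = \sum_(i < l.+1) ('C(k.+1, l - i) * 'C(k + i, i))%:R *: e (k + i).
Proof.
apply: poly_eq_on_nat => m; rewrite hornerM horner_e horner_binp horner_sum.
under eq_bigr do rewrite hornerZ horner_e -natrM.
rewrite -natr_sum -natrM; congr _%:R.
have [km|mk] := leqP k m; last first.
  rewrite (bin_small mk) muln0 big1// => i _.
  by rewrite (@bin_small m) ?muln0//; lia.
under eq_bigr do rewrite -mulnA mul_bin_trinomial// mulnCA.
rewrite -big_distrr/= mulnC; congr muln.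
rewrite -[in LHS](subnK km) -addnS -binomial.Vandermonde.
by apply: eq_bigr => i _; rewrite mulnC.
Qed.

Lemma e_span_lt (K : {poly F} -> Prop) d f : subspace K ->
  (forall k, (k < d)%N -> K (e k)) -> (size f <= d)%N -> K f.
Proof.
move=> sK; elim: d f => [|d IH] f Ke fd.
  by move: fd; rewrite leqn0 size_poly_eq0 => /eqP ->; case: sK.
have ed : (e d)`_d != 0 by rewrite -[d in _`_d]/(d.+1.-1) -(size_e d) lead_coef_eq0 -size_poly_eq0 size_e.
set x := f`_d / (e d)`_d.
apply: (@subspace_subr _ _ K _ (x *: e d)) => //.
  apply: IH => [k kd|]; first by apply: Ke; rewrite ltnS ltnW.
  apply/leq_sizeP => j dj; rewrite coefB coefZ.
  have [->|jd] := eqVneq j d; first by rewrite /x divfK// subrr.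
  have dj' : (d < j)%N by rewrite ltn_neqAle eq_sym jd.
  by rewrite !nth_default ?mulr0 ?subrr// ?size_e//; apply: leq_trans fd _.
by case: sK => _ _; apply; exact: Ke.
Qed.

Lemma e_span (K : {poly F} -> Prop) f : subspace K -> (forall k, K (e k)) -> K f.
Proof. by move=> sK Ke; apply: (e_span_lt (d := size f) sK). Qed.

(** [e 0] is 1 at z = 1 and every other [e k] vanishes there, so the value at 1 is the coordinate
    along [e 0]. *)
Lemma e_span_root (K : {poly F} -> Prop) d f : subspace K ->
  (forall k, (0 < k < d)%N -> K (e k)) -> (size f <= d)%N -> f.[1] = 0 -> K f.
Proof.
move=> sK Ke fd f1; have [K0 KD KZ] := sK.
suff : K (f - f.[1]%:P) by rewrite f1 subr0.
apply: (e_span_lt (d := d) (K := fun f => K (f - f.[1]%:P))) => //.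
  split=> [|x y Kx Ky|c x Kx].
  - by rewrite horner0 subr0.
  - by rewrite hornerD polyCD opprD addrACA; exact: KD.
  - by rewrite hornerZ polyCM mul_polyC -scalerBr; exact: KZ.
move=> k kd; rewrite -[1%R]/(1%:R) (horner_e k 0) bin0n.
case: k kd => [|k] kd; first by rewrite e0 subrr.
by rewrite subr0; exact: Ke.
Qed.

(** Multiplication by z in the coordinates of the basis [e k]: X^k goes to (k + 1)(X^k + X^(k+1)),
    as in [mulX_e]. *)
Definition pD c : {poly F} := (1 + 'X) * ('X * c)^`().

Lemma pD_is_linear : linear pD.
Proof.
by move=> a x y; rewrite /pD mulrDr -scalerAr derivD derivZ mulrDr -scalerAr.
Qed.

HB.instance Definition _ := GRing.isLinear.Build F {poly F} {poly F} _ pD pD_is_linear.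

(** f([pD]) applied to 1, which is the generating polynomial of the coordinates of f in the basis
    [e k]. *)
Definition L f : {poly F} := \sum_(i < size f) f`_i *: iter i pD 1.

Lemma LEw f d : (size f <= d)%N -> L f = \sum_(i < d) f`_i *: iter i pD 1.
Proof.
move=> fd; rewrite /L (big_ord_widen d (fun i => f`_i *: iter i pD 1) fd).
rewrite [RHS](bigID (fun i : 'I_d => (i < size f)%N))/= [X in _ + X]big1 ?addr0// => i.
by rewrite -leqNgt => fi; rewrite nth_default ?scale0r.
Qed.

Lemma L_is_linear : linear L.
Proof.
move=> a x y; set d := maxn (size (a *: x + y)) (maxn (size x) (size y)).
rewrite !(@LEw _ d) ?leq_max ?leqnn ?orbT//.
rewrite scaler_sumr -big_split/=; apply: eq_bigr => i _.
by rewrite coefD coefZ scalerDl scalerA.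
Qed.

HB.instance Definition _ := GRing.isLinear.Build F {poly F} {poly F} _ L L_is_linear.

Lemma L_mulX f : L ('X * f) = pD (L f).
Proof.
rewrite (@LEw ('X * f) (size f).+1); last first.
  by rewrite mulrC; apply: leq_trans (size_polyMleq _ _) _; rewrite size_polyX; lia.
rewrite big_ord_recl coefXM scale0r add0r /L linear_sum; apply: eq_bigr => i _.
by rewrite coefXM linearZ.
Qed.

Lemma L_e k : L (e k) = 'X^k.
Proof.
elim: k => [|k IH]; first by rewrite e0 /L size_poly1 big_ord1 coef1 scale1r.
have k0 : k.+1%:R != 0 :> F by rewrite pnatr_eq0.
suff E : k.+1%:R *: L (e k.+1) = k.+1%:R *: 'X^(k.+1).
  by rewrite -[LHS]scale1r -(mulVf k0) -scalerA E scalerA mulVf// scale1r.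
have := L_mulX (e k); rewrite mulX_e linearZ linearD/= IH.
rewrite /pD -exprS derivXn/= scalerDr => /(canRL (addKr _)) ->.
by rewrite mulrDl mul1r !scaler_nat addKr mulrnAr -exprS.
Qed.

End BinomialPolynomials.

(** * The polynomials P, Q and S of level n *)

Section ZhuPolynomials.
Variables (F : numFieldType) (n : nat).
Hypothesis n_gt0 : (0 < n)%N.
Implicit Types (f g p q c : {poly F}).

Definition polyP : {poly F} := pshift n%:R (binp F (2 * n).+1).

(** The index i = n + 1 carries the root i - n = 1; omitting it divides [polyP] by z - 1. *)
Definition polyQ : {poly F} :=
  ((2 * n).+1)`!%:R^-1 *:
    \prod_(i < (2 * n).+1 | val i != n.+1) ('X - (i%:R - n%:R)%:P).

(* The sum over m of (-1)^m binom(m + n, n) Res_x (1 + x)^(n + z) x^(-n-m-1); its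
   value at an integer -n <= z <= n is 1 for z = 0 and 0 otherwise. *)
Definition polyS : {poly F} :=
  \sum_(m < n.+1) ((-1) ^+ m * ('C(m + n, n))%:R) *: pshift n%:R (binp F (n + m)).

Lemma size_polyP : size polyP = (2 * n).+2.
Proof. by rewrite size_pshift size_binp. Qed.

Lemma polyPE : polyP = ('X - 1) * polyQ.
Proof.
rewrite /polyP /polyQ /pshift /binp comp_polyZ rmorph_prod/= -scalerAr; congr (_ *: _).
have ln : (n.+1 < (2 * n).+1)%N by lia.
rewrite (bigD1 (Ordinal ln))//=; congr (_ * _).
  by rewrite comp_polyB comp_polyX comp_polyC -addrA -polyCB -natr1 opprD addNKr polyCN.
apply: eq_big => [i|i _]; first by rewrite -val_eqE.
by rewrite comp_polyB comp_polyX comp_polyC polyCB opprB addrA addrAC -addrA.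
Qed.

Lemma size_polyQ : size polyQ = (2 * n).+1.
Proof.
have := size_polyP; rewrite polyPE -polyC1 size_monicM ?monicXsubC//.
  by rewrite size_XsubC => -[].
by apply: contra_eqN size_polyP => /eqP Q0; rewrite polyPE Q0 mulr0 size_poly0.
Qed.

Lemma polyQ1 : polyQ.[1] != 0.
Proof.
rewrite hornerZ horner_prod mulf_neq0 ?invr_eq0 ?pnatr_eq0 -?lt0n ?fact_gt0//.
apply/prodf_neq0 => i /= ni; rewrite hornerXsubC opprB addrA subr_eq0.
by rewrite nat1r eqr_nat eq_sym.
Qed.

Lemma size_polyS : (size polyS <= (2 * n).+1)%N.
Proof.
rewrite (leq_trans (size_sum _ _ _))//; apply/bigmax_leqP => m _.
rewrite (leq_trans (size_scale_leq _ _))// size_pshift size_binp.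
by have := ltn_ord m; lia.
Qed.

(** Only the summand m = n reaches degree 2n. *)
Lemma coef_polyS : polyS`_(2 * n) != 0.
Proof.
rewrite /polyS big_ord_recr /= coefD coef_sum big1 => [|m _]; last first.
  rewrite coefZ nth_default ?mulr0// size_pshift size_binp.
  by have := ltn_ord m; lia.
rewrite add0r coefZ mulf_neq0//.
  by rewrite mulf_neq0 ?signr_eq0// pnatr_eq0 -lt0n bin_gt0; lia.
set p := pshift _ _.
have sp : size p = (2 * n).+1 by rewrite size_pshift size_binp; lia.
by rewrite -[(2 * n)%N]/((2 * n).+1.-1) -sp lead_coef_eq0 -size_poly_eq0 sp.
Qed.

(** At z = 1 only m = 0 and m = 1 contribute, with values n + 1 and -(n + 1). *)
Lemma polyS1 : polyS.[1] = 0.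
Proof.
rewrite horner_sum; case: n n_gt0 => // k _.
rewrite big_ord_recl big_ord_recl big1 => [|m _]; last first.
  by rewrite hornerZ horner_pshift nat1r horner_binp (@bin_small k.+2) ?mulr0//= /bump !leq0n; lia.
rewrite !hornerZ !horner_pshift !nat1r !horner_binp /= /bump/=.
rewrite !addn0 !add1n addn1 add0n !binn binSn.
by rewrite expr0 expr1; ring.
Qed.

Lemma polyS_reduce f : (size f <= (2 * n).+1)%N ->
  exists b, (size (f - b *: polyS)%R <= 2 * n)%N.
Proof.
move=> sf; exists (f`_(2 * n) / polyS`_(2 * n)); apply/leq_sizeP => j.
rewrite leq_eqVlt coefB coefZ => /orP[/eqP<-|nj].
  by rewrite divfK ?subrr// coef_polyS.
rewrite (nth_default _ (leq_trans sf nj)).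
by rewrite (nth_default _ (leq_trans size_polyS nj)) mulr0 subrr.
Qed.

End ZhuPolynomials.

(** * Commuting creation operators *)

(** The linear form attached to f: [L f] holds the coordinates of f in the basis [e k], and [X k]
    stands for alpha(-k-1), with index shifted by one. *)
HB.lock Definition Op (F : numFieldType) (U : lmodType F)
    (X : nat -> {linear U -> U}) (f : {poly F}) (v : U) : U :=
  \sum_(k < size (L f)) (L f)`_k *: X k v.

Section Triangle.
Variable (U : nmodType).

Lemma sum_triangle (G : nat -> nat -> U) J :
  \sum_(l < J.+1) \sum_(i < l.+1) G i (l - i)%N =
  \sum_(i < J.+1) \sum_(t < (J - i).+1) G i t.
Proof.
elim: J => [|J IH]; first by rewrite big_ord1 [RHS]big_ord1 /= !big_ord1.
rewrite big_ord_recr/= IH [RHS]big_ord_recr/= subnn big_ord1.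
rewrite [X in _ + X = _]big_ord_recr/= subnn addrA; congr (_ + _).
rewrite -big_split/=; apply: eq_bigr => i _.
by rewrite (subSn (ltn_ord i : i <= J)%N) [RHS]big_ord_recr.
Qed.

Lemma sum_triangle_sym (G : nat -> nat -> U) J :
  \sum_(i < J.+1) \sum_(t < (J - i).+1) G i t =
  \sum_(t < J.+1) \sum_(i < (J - t).+1) G i t.
Proof.
rewrite -sum_triangle -(sum_triangle (fun t i => G i t)).
apply: eq_bigr => l _; rewrite (reindex_inj rev_ord_inj)/=.
by apply: eq_bigr => i _; rewrite subSS subKn// -ltnS.
Qed.

End Triangle.

Section Operators.
Variables (F : numFieldType) (U : lmodType F) (X : nat -> {linear U -> U}).
Local Notation Op := (Op X).
Implicit Types (u v x y : U) (f g h p : {poly F}) (fs gs : seq {poly F}).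

Lemma XZ c k v : X k (c *: v) = c *: X k v.
Proof. exact: linearZ. Qed.

Lemma X_sum I (s : seq I) (p : pred I) k (h : I -> U) :
  X k (\sum_(i <- s | p i) h i) = \sum_(i <- s | p i) X k (h i).
Proof. exact: linear_sum. Qed.

Lemma OpE f v : Op f v = \sum_(k < size (L f)) (L f)`_k *: X k v.
Proof. by rewrite unlock. Qed.

Lemma OpEw f v d : (size (L f) <= d)%N -> Op f v = \sum_(k < d) (L f)`_k *: X k v.
Proof.
move=> fd; rewrite OpE (big_ord_widen d (fun i => (L f)`_i *: X i v) fd).
rewrite [RHS](bigID (fun i : 'I_d => (i < size (L f))%N))/= [X in _ + X]big1 ?addr0// => i.
by rewrite -leqNgt => fi; rewrite nth_default ?scale0r.
Qed.

Lemma Op_is_linear f : linear (Op f).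
Proof.
move=> a x y; rewrite !OpE scaler_sumr -big_split/=; apply: eq_bigr => i _.
by rewrite linearP scalerDr !scalerA mulrC.
Qed.

HB.instance Definition _ f := GRing.isLinear.Build F U U _ (Op f) (Op_is_linear f).

Definition Opl v f := Op f v.

Lemma Opl_is_linear v : linear (Opl v).
Proof.
move=> a f g; rewrite /Opl.
set d := maxn (size (L (a *: f + g))) (maxn (size (L f)) (size (L g))).
rewrite !(@OpEw _ _ d) ?leq_max ?leqnn ?orbT//.
rewrite scaler_sumr -big_split/=; apply: eq_bigr => i _.
by rewrite linearP coefD coefZ scalerDl scalerA.
Qed.

HB.instance Definition _ v :=
  GRing.isLinear.Build F {poly F} U _ (Opl v) (Opl_is_linear v).

Lemma OpZl c f v : Op (c *: f) v = c *: Op f v.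
Proof. exact: (linearZ_LR (Opl v)). Qed.

Lemma OpDl f g v : Op (f + g) v = Op f v + Op g v.
Proof. exact: (linearD (Opl v)). Qed.

Lemma Op_suml I (s : seq I) (p : pred I) (h : I -> {poly F}) v :
  Op (\sum_(i <- s | p i) h i) v = \sum_(i <- s | p i) Op (h i) v.
Proof. exact: (linear_sum (Opl v)). Qed.

Lemma OpZr c f v : Op f (c *: v) = c *: Op f v.
Proof. exact: linearZ. Qed.

Lemma Op_e k v : Op (e F k) v = X k v.
Proof.
rewrite (@OpEw _ _ k.+1) L_e ?size_polyXn// big_ord_recr/= coefXn eqxx scale1r.
by rewrite big1 ?add0r// => i _; rewrite coefXn ltn_eqF ?scale0r.
Qed.

(** Coefficient of x^J in the part of Y(u, x) v made of creation operators only, for u with parts w: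
    a part k contributes sum_i binom(k + i - 1, i) x^i alpha(-k-i). *)
Fixpoint lead (w : seq nat) (J : nat) v : U :=
  match w with
  | [::] => if J == 0%N then v else 0
  | k :: w' => \sum_(i < J.+1) 'C(k + i - 1, i)%:R *: X (k + i - 1) (lead w' (J - i) v)
  end.

(** The same indexed by modes: u_(q) goes with x^(-q-1), and [Negz J] is -J-1. Modes q >= 0 have no
    such part. *)
Definition leadz w (q : int) v := if q is Negz J then lead w J v else 0.

(* The coefficient of x^J in (1 + x)^N prod_(f <- fs) Op (f (1 + x)^z) v. *)
Fixpoint prod_coef (fs : seq {poly F}) (N J : nat) v : U :=
  match fs with
  | [::] => 'C(N, J)%:R *: v
  | f :: fs' => \sum_(l < J.+1) Op (binp F l * f) (prod_coef fs' N (J - l) v)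
  end.

(** By [binp_mul_e] each factor (1 + x)^z alpha(-k) splits off (1 + x)^k; with (1 + x)^N these
    collect into (1 + x)^(sumn w + N) and leave the series of [lead]. *)
Lemma prod_coef_e w N J v : positive w ->
  prod_coef [seq e F k.-1 | k <- w] N J v =
  \sum_(j < J.+1) 'C(sumn w + N, j)%:R *: lead w (J - j) v.
Proof.
elim: w J => [|k w IH] J /=.
  move=> _; rewrite big_ord_recr/= subnn eqxx big1 ?add0r// => j _.
  by rewrite subn_eq0 leqNgt ltn_ord scaler0.
case/andP=> k0 pos_w; set M := (sumn w + N)%N.
(* Here t is the power taken from (1 + x)^k and i the one taken from the translation series of
   alpha(-k). *)
pose B i t := 'C(k, t)%:R *: ('C(k + i - 1, i)%:R *: X (k + i - 1)
  (\sum_(j < (J - i - t).+1) 'C(M, j)%:R *: lead w (J - i - t - j) v)).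
transitivity (\sum_(l < J.+1) \sum_(i < l.+1) B i (l - i)%N).
  apply: eq_bigr => l _; rewrite binp_mul_e prednK// Op_suml.
  apply: eq_bigr => i _; rewrite OpZl Op_e (IH _ pos_w) /B natrM -scalerA.
  have -> : (k.-1 + i = k + i - 1)%N by lia.
  by rewrite -(subnDA i) (subnKC (ltn_ord i : i <= l)%N).
rewrite sum_triangle.
transitivity (\sum_(i < J.+1) 'C(k + i - 1, i)%:R *: X (k + i - 1)
   (\sum_(s < (J - i).+1) 'C(k + M, s)%:R *: lead w (J - i - s) v)).
  apply: eq_bigr => i _; rewrite /B.
  under eq_bigr do rewrite scalerA mulrC -scalerA -XZ.
  rewrite -scaler_sumr -X_sum; congr (_ *: X _ _).
  under eq_bigr do rewrite scaler_sumr.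
  transitivity (\sum_(t < (J - i).+1) \sum_(j < ((J - i) - t).+1)
    ('C(k, t) * 'C(M, j))%:R *: lead w (J - i - (t + j)) v).
    apply: eq_bigr => t _; apply: eq_bigr => j _.
    by rewrite scalerA natrM subnDA.
  rewrite -(sum_triangle (fun t j => ('C(k, t) * 'C(M, j))%:R *: lead w (J - i - (t + j)) v)).
  apply: eq_bigr => s _; rewrite -binomial.Vandermonde natr_sum scaler_suml.
  by apply: eq_bigr => t _; rewrite (subnKC (ltn_ord t : t <= s)%N).
transitivity (\sum_(i < J.+1) \sum_(s < (J - i).+1)
   'C(k + M, s)%:R *: ('C(k + i - 1, i)%:R *: X (k + i - 1) (lead w (J - i - s) v))).
  apply: eq_bigr => i _; rewrite X_sum scaler_sumr; apply: eq_bigr => s _.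
  by rewrite XZ !scalerA mulrC.
rewrite (sum_triangle_sym (fun i s =>
  'C(k + M, s)%:R *: ('C(k + i - 1, i)%:R *: X (k + i - 1) (lead w (J - i - s) v)))).
apply: eq_bigr => j _; rewrite scaler_sumr addnA; apply: eq_bigr => i _.
by rewrite subnAC.
Qed.

(** Any cutoff M >= |q| serves, as the terms with q + i >= 0 vanish; this allows the truncation made
    in [modeB]. *)
Lemma leadz_cons k w q v M : (`|q| <= M)%N ->
  leadz (k :: w) q v =
  \sum_(i < M.+1) 'C(k + i - 1, i)%:R *: X (k + i - 1) (leadz w (q + i%:Z) v).
Proof.
case: q => J JM.
  by rewrite big1// => i _; rewrite -PoszD /= linear0 scaler0.
have JM' : (J.+1 <= M.+1)%N by apply: leq_trans JM _.
rewrite /= (big_ord_widen M.+1 (fun i =>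
  'C(k + i - 1, i)%:R *: X (k + i - 1) (lead w (J - i) v)) JM') big_mkcond/=.
apply: eq_bigr => i _; case: ifP => iJ.
  by have -> : Negz J + i%:Z = Negz (J - i) by lia.
have -> : Negz J + i%:Z = Posz (i - J.+1) by lia.
by rewrite /= linear0 scaler0.
Qed.

Lemma prod_coef_leadz w N T v : positive w ->
  prod_coef [seq e F k.-1 | k <- w] N T v =
  \sum_(j < (sumn w + N).+1) 'C(sumn w + N, j)%:R *: leadz w (Negz T + j%:Z) v.
Proof.
move=> pos_w; rewrite prod_coef_e//; set M := (sumn w + N)%N.
pose B (j : nat) := 'C(M, j)%:R *: leadz w (Negz T + j%:Z) v.
(* Both sums extend to j <= T + M: for j > T the mode is nonnegative, for j > M the binomial
   vanishes. *)
transitivity (\sum_(j < (T + M).+1) B j).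
  rewrite (big_ord_widen (T + M).+1 (fun j : nat => 'C(M, j)%:R *: lead w (T - j) v)) ?ltnS ?leq_addr//.
  rewrite big_mkcond; apply: eq_bigr => j _; rewrite /B; case: ifP => jT.
    by have -> : Negz T + j%:Z = Negz (T - j) by lia.
  have -> : Negz T + j%:Z = Posz (j - T.+1) by lia.
  by rewrite scaler0.
rewrite [RHS](big_ord_widen (T + M).+1 B) ?ltnS ?leq_addl// [RHS]big_mkcond.
apply: eq_bigr => j _; case: ifP => // jM.
by rewrite /B bin_small ?scale0r//; lia.
Qed.

Lemma prod_coef1 f N J v : prod_coef [:: f] N J v = Op (pshift N%:R (binp F J) * f) v.
Proof.
rewrite /= -binp_vandermonde mulr_suml Op_suml.
by apply: eq_bigr => l _; rewrite OpZr -OpZl scalerAl.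
Qed.

Hypothesis X_comm : forall j k v, X j (X k v) = X k (X j v).

Lemma Op_comm f g v : Op f (Op g v) = Op g (Op f v).
Proof.
rewrite (OpE g v) (OpE g (Op f v)) linear_sum; apply: eq_bigr => i _.
rewrite linearZ/=; congr (_ *: _).
rewrite !OpE X_sum; apply: eq_bigr => j _.
by rewrite XZ X_comm.
Qed.

Lemma prod_coef_swap f g fs N J v : prod_coef (f :: g :: fs) N J v = prod_coef (g :: f :: fs) N J v.
Proof.
rewrite /=.
under eq_bigr do rewrite linear_sum.
under [RHS]eq_bigr do rewrite linear_sum.
rewrite (sum_triangle_sym (fun l m =>
  Op (binp F l * f) (Op (binp F m * g) (prod_coef fs N (J - l - m) v)))).
by apply: eq_bigr => i _; apply: eq_bigr => j _; rewrite subnAC; exact: Op_comm.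
Qed.

Lemma prod_coef_move f fs gs N J v :
  prod_coef (fs ++ f :: gs) N J v = prod_coef (f :: fs ++ gs) N J v.
Proof.
elim: fs J => // h fs IH J.
transitivity (prod_coef (h :: f :: fs ++ gs) N J v); last exact: prod_coef_swap.
by apply: eq_bigr => l _; congr (Op _ _); exact: IH.
Qed.

Lemma prod_coef_perm fs gs N J v : perm_eq fs gs -> prod_coef fs N J v = prod_coef gs N J v.
Proof.
elim: fs gs J => [|f fs IH] gs J; first by move/perm_size/esym/eqP/nilP => ->.
move=> p; have fgs : f \in gs by rewrite -(perm_mem p) mem_head.
move: p; case/splitPr: fgs => g1 g2.
rewrite perm_sym -cat1s perm_catCA/= perm_cons perm_sym => p.
by rewrite prod_coef_move; apply: eq_bigr => l _; congr (Op _ _); exact: IH.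
Qed.

Definition prod_coef_head fs N J v f := prod_coef (f :: fs) N J v.

Lemma prod_coef_head_is_linear fs N J v : linear (prod_coef_head fs N J v).
Proof.
move=> a f g; rewrite /prod_coef_head /= scaler_sumr -big_split/=.
apply: eq_bigr => l _; rewrite mulrDr -scalerAr.
exact: (linearP (Opl (prod_coef fs N (J - l) v))).
Qed.

HB.instance Definition _ fs N J v :=
  GRing.isLinear.Build F {poly F} U _ (prod_coef_head fs N J v) (prod_coef_head_is_linear fs N J v).

(** By symmetry each factor can be moved to the front, where [prod_coef] is linear, and expanded
    there in the basis [e k]. *)
Lemma prod_coef_span (K : U -> Prop) fs N J v : subspace K ->
  (forall w, size w = size fs -> K (prod_coef [seq e F k | k <- w] N J v)) ->
  K (prod_coef fs N J v).
Proof.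
move=> sK Kw; suff H w gs : (size w + size gs = size fs)%N ->
    K (prod_coef ([seq e F k | k <- w] ++ gs) N J v) by exact: (H [::] fs).
elim: gs w => [|f gs IH] w sz; first by rewrite cats0; apply: Kw; rewrite -sz addn0.
rewrite prod_coef_move -[prod_coef _ _ _ _]/(prod_coef_head _ N J v f).
apply: (e_span (K := fun f => K (prod_coef_head _ N J v f))) => [|k].
  exact: subspace_preim.
by rewrite /prod_coef_head -cat_cons -map_cons; apply: IH; rewrite addSnnS.
Qed.

Lemma iter_Op_comm i f g v : iter i (Op f) (Op g v) = Op g (iter i (Op f) v).
Proof. by elim: i => //= i ->; exact: Op_comm. Qed.

Lemma iter_Op_X i f k v : iter i (Op f) (X k v) = X k (iter i (Op f) v).
Proof. by rewrite -!Op_e iter_Op_comm. Qed.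

(** * Reduction of monomials modulo shorter ones *)

Section Filtration.
Variable shorter : nat -> U -> Prop.
Hypothesis shorter_subspace : forall d, subspace (shorter d).
Hypothesis shorter_le : forall d d' v, (d <= d')%N -> shorter d v -> shorter d' v.
Hypothesis shorter_X : forall d k v, shorter d v -> shorter d.+1 (X k v).

Lemma shorter_Op d f v : shorter d v -> shorter d.+1 (Op f v).
Proof.
move=> Fv; rewrite OpE; apply: (subspace_sum _ (shorter_subspace _)) => i _.
by have [_ _] := shorter_subspace d.+1; apply; apply: shorter_X.
Qed.

Lemma shorter_lead d w J v : shorter d v -> shorter (d + size w) (lead w J v).
Proof.
move=> Fv; elim: w J => [|k w IH] J /=.
  by rewrite addn0; case: eqP => // _; case: (shorter_subspace d).
apply: (subspace_sum _ (shorter_subspace _)) => i _.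
have [_ _ FZ] := shorter_subspace (d + (size w).+1).
by apply: FZ; rewrite addnS; apply: shorter_X.
Qed.

Lemma shorter_leadz d w q v : shorter d v -> shorter (d + size w) (leadz w q v).
Proof.
by case: q => J Fv /=; [case: (shorter_subspace (d + size w)) | exact: shorter_lead].
Qed.

Lemma shorter_prod_coef d fs N J v : shorter d v -> shorter (d + size fs) (prod_coef fs N J v).
Proof.
move=> Fv; elim: fs J => [|f fs IH] J /=.
  by rewrite addn0; case: (shorter_subspace d) => _ _; apply.
apply: (subspace_sum _ (shorter_subspace _)) => l _.
by rewrite addnS; apply: shorter_Op.
Qed.

Variable vac : U.
Hypothesis shorter_vac : shorter 1 vac.
Variable n : nat.
Hypothesis n_gt0 : (0 < n)%N.
Local Notation P := (polyP F n).
Local Notation Q := (polyQ F n).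
Local Notation S := (polyS F n).

Definition word (w : seq nat) : U := foldr (fun k => X k.-1) vac w.

Lemma word_perm w1 w2 : perm_eq w1 w2 -> word w1 = word w2.
Proof.
elim: w1 w2 => [|k w1 IH] w2; first by move/perm_size/esym/eqP/nilP => ->.
move=> p; have kw2 : k \in w2 by rewrite -(perm_mem p) mem_head.
move: p; case/splitPr: kw2 => s1 s2.
rewrite perm_sym -cat1s perm_catCA/= perm_cons perm_sym => /IH ->.
by elim: s1 => //= j s1 <-; rewrite X_comm.
Qed.

Lemma shorter_word w : shorter (size w).+1 (word w).
Proof. by elim: w => //= k w IH; apply: shorter_X. Qed.

Definition letters (w : seq nat) := all (fun k => 0 < k <= 2 * n)%N w.

(** A span encoded as the intersection of all subspaces containing the generators, so that
    membership is used by applying it to a subspace. *)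
Definition rel_span d x := forall K, subspace K ->
  (forall g z, shorter d z -> K (Op (P * g) z)) -> K x.

Lemma rel_span_subspace d : subspace (rel_span d).
Proof.
split=> [K [K0 _ _]|x y Rx Ry K sK KP|c x Rx K sK KP] //; have [_ KD KZ] := sK.
  by apply: KD; [exact: Rx | exact: Ry].
by apply: KZ; exact: Rx.
Qed.

Lemma rel_span_le d d' x : (d <= d')%N -> rel_span d x -> rel_span d' x.
Proof. by move=> dd' Rx K sK KP; apply: Rx => // g z /(shorter_le dd'); exact: KP. Qed.

Lemma rel_span_gen d g z : shorter d z -> rel_span d (Op (P * g) z).
Proof. by move=> Fz K _; apply. Qed.

Lemma rel_span_Op d h x : rel_span d x -> rel_span d.+1 (Op h x).
Proof.
move=> Rx K sK KP; apply: (Rx (fun x => K (Op h x))); first exact: subspace_preim.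
by move=> g z Fz; rewrite Op_comm; apply/KP/shorter_Op.
Qed.

(** Modulo P = (z - 1) Q, multiplication by z fixes Q, so binom(z, l) acts on Q as binom(1, l). *)
Lemma binp_mul_polyQ l : exists h, binp F l * Q = 'C(1, l)%:R *: Q + P * h.
Proof.
have : root (binp F l - 'C(1, l)%:R%:P) 1.
  by rewrite /root hornerD hornerN hornerC -[X in _.[X]]/(1%:R) horner_binp subrr.
move/factor_theorem=> [h hE]; exists h.
rewrite -mul_polyC -(subrK ('C(1, l)%:R%:P) (binp F l)) hE mulrDl addrC.
by congr (_ + _); rewrite polyPE// polyC1; ring.
Qed.

(** Modulo the relations (1 + x)^z Q is (1 + x) Q, so s factors Q turn (1 + x)^N into (1 + x)^(N +
    s). *)
Lemma prod_coef_polyQ d s N J y : shorter d.+1 y ->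
  rel_span (d + s) (prod_coef (nseq s Q) N J y - 'C(N + s, J)%:R *: iter s (Op Q) y).
Proof.
move=> Fy; elim: s J => [|s IH] J.
  by rewrite /= !addn0 subrr; case: (rel_span_subspace d).
have -> : 'C(N + s.+1, J)%:R *: iter s.+1 (Op Q) y =
    \sum_(l < J.+1) 'C(1, l)%:R *: Op Q ('C(N + s, J - l)%:R *: iter s (Op Q) y).
  rewrite addnS -add1n -binomial.Vandermonde natr_sum scaler_suml.
  by apply: eq_bigr => l _; rewrite linearZ/= scalerA natrM.
rewrite /= -sumrB; apply: (subspace_sum _ (rel_span_subspace _)) => l _.
have [h ->] := binp_mul_polyQ l.
rewrite OpDl OpZl addrAC -scalerBr -linearB.
have [_ RD RZ] := rel_span_subspace (d + s.+1); rewrite addnS in RD RZ *.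
apply: RD; first by apply: RZ; apply: rel_span_Op.
by apply: rel_span_gen; have := shorter_prod_coef (nseq s Q) N (J - l) Fy; rewrite size_nseq addSn.
Qed.

(* Words in the operators Op S ~ (alpha * _) and alpha(-1), ..., alpha(-2n). *)
Definition word_span c len x := forall K, subspace K ->
  (forall i w, letters w -> (count_mem 1%N w <= c)%N ->
     (i + size w = len)%N -> K (iter i (Op S) (word w))) -> K x.

Lemma word_span_subspace c len : subspace (word_span c len).
Proof.
split=> [K [K0 _ _]|x y Rx Ry K sK KP|b x Rx K sK KP] //; have [_ KD KZ] := sK.
  by apply: KD; [exact: Rx | exact: Ry].
by apply: KZ; exact: Rx.
Qed.

Lemma word_span_gen c i w : letters w ->
  (count_mem 1%N w <= c)%N -> word_span c (i + size w) (iter i (Op S) (word w)).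
Proof. by move=> w2n wc K _; apply. Qed.

Lemma word_span_le c c' len x : (c <= c')%N -> word_span c len x -> word_span c' len x.
Proof.
move=> cc' Wx K sK KW; apply: Wx => // i w w2n wc.
by apply: KW => //; apply: leq_trans cc'.
Qed.

Lemma shorter_word_span c len x : word_span c len x -> shorter len.+1 x.
Proof.
apply=> [|i w w2n _ <-]; first exact: shorter_subspace.
elim: i => [|i IH]; last exact: shorter_Op.
exact: shorter_word.
Qed.

Lemma word_span_X c len k x : (k < 2 * n)%N -> word_span c len x ->
  word_span (c + (k == 0%N)) len.+1 (X k x).
Proof.
move=> k2n Wx K sK KW; apply: (Wx (fun x => K (X k x))) => [|i w w2n wc iw].
  exact: subspace_preim.
rewrite -iter_Op_X -[X k _]/(word (k.+1 :: w)).
apply: KW => /=; first by rewrite /letters /= k2n.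
  by rewrite eqSS addnC leq_add.
by rewrite addnS iw.
Qed.

Lemma word_span_polyS c len x : word_span c len x -> word_span c len.+1 (Op S x).
Proof.
move=> Wx K sK KW; apply: (Wx (fun x => K (Op S x))) => [|i w w2n wc iw].
  exact: subspace_preim.
by rewrite -iterS; apply: KW => //; rewrite addSn iw.
Qed.

Lemma word_span_Op_lt c len f x : (size f <= 2 * n)%N -> word_span c len x ->
  word_span c.+1 len.+1 (Op f x).
Proof.
move=> sf Wx; rewrite -[Op f x]/(Opl x f).
apply: (e_span_lt (d := (2 * n)%N) (K := fun f => word_span c.+1 len.+1 (Opl x f))) => // [|k kn].
  exact/subspace_preim/word_span_subspace.
rewrite /Opl Op_e; apply: (@word_span_le (c + (k == 0%N))); first by case: eqP; lia.
exact: word_span_X.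
Qed.

Lemma word_span_Op_root c len f x : (size f <= 2 * n)%N -> f.[1] = 0 ->
  word_span c len x -> word_span c len.+1 (Op f x).
Proof.
move=> sf f1 Wx; rewrite -[Op f x]/(Opl x f).
apply: (e_span_root (d := (2 * n)%N) (K := fun f => word_span c len.+1 (Opl x f))) => // [|k /andP[k0 kn]].
  exact/subspace_preim/word_span_subspace.
rewrite /Opl Op_e; apply: (@word_span_le (c + (k == 0%N))); first by rewrite gtn_eqF// addn0.
exact: word_span_X.
Qed.

(** A multiple of S absorbs the term of degree 2n; the rest involves only alpha(-1), ...,
    alpha(-2n), hence at most one more alpha(-1). *)
Lemma word_span_Op c len f x : (size f <= (2 * n).+1)%N -> word_span c len x ->
  word_span c.+1 len.+1 (Op f x).
Proof.
move=> /(polyS_reduce n_gt0)[b sb] Wx; rewrite -(subrK (b *: S) f).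
have [_ WD WZ] := word_span_subspace c.+1 len.+1.
rewrite OpDl OpZl; apply: WD; first exact: word_span_Op_lt.
apply: WZ; apply: word_span_le (leqnSn c) _; exact: word_span_polyS Wx.
Qed.

(* Q = beta + rho with beta != 0, where Op rho does not involve alpha(-1). *)
Lemma word_span_polyQ_tail c len x : word_span c len x -> word_span c len.+1 (Op (Q - Q.[1]%:P) x).
Proof.
have [b sb] := polyS_reduce n_gt0 (eq_leq (size_polyQ F n_gt0)).
move=> Wx; have -> : Q - Q.[1]%:P = b *: S + (Q - b *: S - Q.[1]%:P) by ring.
rewrite OpDl OpZl.
have [_ WD WZ] := word_span_subspace c len.+1.
apply: WD; first by apply: WZ; exact: word_span_polyS Wx.
apply: word_span_Op_root => //.
  rewrite (leq_trans (size_polyD _ _))// geq_max sb size_polyN.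
  by rewrite (leq_trans (size_polyC_leq1 _))//; lia.
by rewrite !hornerE polyS1// mulr0 subr0 subrr.
Qed.

Variable G : U -> Prop.
Hypothesis G_subspace : subspace G.

Section Level.
Variable r : nat.
Hypothesis low : forall v, shorter r v -> G v.
(** This and the next hypothesis will come from u o_n v in O_n and from iterated products alpha(-1)
    *_n g, each corrected by shorter vectors through [low]. *)
Hypothesis circ_G : forall d w v, shorter d v -> ((d + size w).-1 <= r)%N ->
  G (prod_coef [seq e F k | k <- w] n (2 * n).+1 v).
Hypothesis star_G : forall i w, letters w -> (count_mem 1%N w <= n)%N ->
  (i + size w <= r)%N -> G (iter i (Op S) (word w)).

Lemma generated_prod_coef d fs v : shorter d v -> ((d + size fs).-1 <= r)%N ->
  G (prod_coef fs n (2 * n).+1 v).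
Proof.
move=> Fv dr; apply: prod_coef_span => // w szw.
by apply: (circ_G Fv); rewrite szw.
Qed.

(** P g is the coefficient of x^(2n+1) in (1 + x)^(n+z) g: the leading part of a circle product with
    u of length one. *)
Lemma generated_rel_span x : rel_span r x -> G x.
Proof.
apply=> [|g z Fz]; first exact: G_subspace.
rewrite -[P]/(pshift n%:R (binp F (2 * n).+1)) -prod_coef1.
by apply: generated_prod_coef Fz _; rewrite addn1.
Qed.

Lemma generated_polyQ d y : shorter d.+1 y -> (d + n < r)%N ->
  G (iter n.+1 (Op Q) y).
Proof.
move=> Fy dr; have := @prod_coef_polyQ d n.+1 n (2 * n).+1 y Fy.
(* With s factors Q the coefficient is binom(n + s, 2n + 1); s = n + 1 is the least s for which it
   is nonzero, and it is then 1. *)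
have -> : (n + n.+1 = (2 * n).+1)%N by lia.
rewrite binn scale1r addnS => /(rel_span_le dr)/generated_rel_span Gdiff.
rewrite -[iter _ _ _](subKr (prod_coef (nseq n.+1 Q) n (2 * n).+1 y)).
apply: (subspaceB G_subspace) Gdiff.
by apply: generated_prod_coef Fy _; rewrite size_nseq addSn/= addnS.
Qed.

(** Induction on c, the excess of alpha(-1) over n: n + 1 factors alpha(-1) are exchanged for
    factors Q one at a time, at the cost of words covered by the induction hypothesis. *)
Lemma generated_word_span c len x : (len <= r)%N -> word_span (n + c) len x -> G x.
Proof.
elim: c len x => [|c IH] len x lr.
  rewrite addn0; apply=> [|i w w2n w1 iw]; first exact: G_subspace.
  by apply: star_G => //; rewrite iw.
rewrite addnS; apply=> [|i w w2n w1 iw]; first exact: G_subspace.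
have [w1'|w1'] := leqP (count_mem 1%N w) (n + c).
  by apply: (IH _ _ lr); rewrite -iw; exact: word_span_gen.
have {w1 w1'} w1 : count_mem 1%N w = (n + c).+1 by apply/eqP; rewrite eqn_leq w1.
(* [w'] is w without n + 1 of its n + c + 1 letters 1. *)
set w' := nseq c 1%N ++ [seq k <- w | k != 1%N].
have ww' : perm_eq w (nseq n.+1 1%N ++ w').
  have w1E : [seq k <- w | pred1 1%N k] = nseq (count_mem 1%N w) 1%N.
    by rewrite -size_filter; apply/all_pred1P; rewrite filter_all.
  rewrite /w' catA -nseqD addSn -w1 -w1E perm_sym.
  exact: (permEl (perm_filterC (pred1 1%N) w)).
have w'2n : letters w'.
  by move: w2n; rewrite /letters (perm_all _ ww') all_cat => /andP[].
have w'1 : (count_mem 1%N w' <= c)%N.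
  by move: w1; rewrite (permP ww') count_cat count_nseq/= mul1n; lia.
clearbody w'; set y := iter i (Op S) (word w'); set d := (i + size w')%N.
have Wy : word_span c d y by exact: word_span_gen.
have dn : (d + n.+1)%N = len by rewrite /d -iw (perm_size ww') size_cat size_nseq -addnA (addnC (size w')).
have -> : iter i (Op S) (word w) = iter n.+1 (X 0) y.
  rewrite (word_perm ww'); elim: n.+1 => //= m <-.
  exact: iter_Op_X.
(* Hybrids with s factors alpha(-1) and n + 1 - s factors Q: s = 0 is [generated_polyQ], s = n + 1
   is the goal. *)
suff H s : (s <= n.+1)%N -> G (iter (n.+1 - s) (Op Q) (iter s (X 0) y)).
  by have := H n.+1 (leqnn _); rewrite subnn.
elim: s => [|s IHs] sn.
  rewrite subn0; apply: (@generated_polyQ d); first exact: shorter_word_span Wy.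
  by move: dn; clearbody d; lia.
have {IHs} := IHs (ltnW sn); rewrite subSS subSn// iterSr.
set t := (n - s)%N; set x0 := iter s (X 0) y => Gx.
have [_ _ GZ] := G_subspace.
rewrite -[iter t _ _]scale1r -(mulVf (polyQ1 F n)) -scalerA; apply: GZ.
have Wx0 : word_span (c + s) (d + s) x0.
  rewrite /x0; elim: s {sn t x0 Gx} => [|s IHs]; first by rewrite !addn0.
  have n2 : (0 < 2 * n)%N by rewrite muln_gt0.
  by have := word_span_X n2 IHs; rewrite eqxx addn1 !addnS.
have WQ m z l l' : word_span l l' z -> word_span (l + m) (l' + m) (iter m (Op Q) z).
  move=> Wz; elim: m => [|m IHm]; first by rewrite !addn0.
  by rewrite !addnS; apply: word_span_Op => //; rewrite size_polyQ.
(* Q(1) alpha(-1) is Q - (Q - Q(1)), as the constant 1 is [e 0]. *)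
have -> : Q.[1] *: iter t (Op Q) (iter s.+1 (X 0) y) =
    iter t (Op Q) (Op Q x0) - iter t (Op Q) (Op (Q - Q.[1]%:P) x0).
  have itB m u v : iter m (Op Q) (u - v) = iter m (Op Q) u - iter m (Op Q) v.
    by elim: m => //= m ->; rewrite linearB.
  have itZ m b u : iter m (Op Q) (b *: u) = b *: iter m (Op Q) u.
    by elim: m => //= m ->; rewrite linearZ.
  rewrite -itB -[X in iter t _ (Op Q x0 - X)]/(Opl x0 _) -[Op Q x0]/(Opl x0 Q) -linearB/= subKr.
  by rewrite -alg_polyC /Opl OpZl -(e0 F) Op_e itZ.
(* Count of alpha(-1): at most c from y, s from the hybrid, none from Q - Q(1), and one from each of
   the n - s factors Q, so n + c in all. *)
apply: (subspaceB G_subspace Gx); apply: (IH len) => //.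
have := WQ t _ _ _ (word_span_polyQ_tail Wx0).
have -> : (c + s + t = n + c)%N by rewrite /t; lia.
by have -> : ((d + s).+1 + t = len)%N by rewrite /t; lia.
Qed.

(** Dividing each letter by P leaves a remainder of degree at most 2n, so every word is a sum of
    elements of some [word_span] and of [rel_span]. *)
Lemma word_level w : positive w -> (size w <= r)%N -> G (word w).
Proof.
(* An arbitrary K encodes the sum of these spans, so that the induction can pass to the preimage of
   K under [X k.-1]. *)
move=> pos_w wr; suff H K : subspace K -> (forall c x, word_span c (size w) x -> K x) ->
    (forall x, rel_span (size w) x -> K x) -> K (word w).
  apply: (H _ G_subspace) => [c x Wx|x Rx].
    by apply: (@generated_word_span c _ _ wr); apply: word_span_le Wx; rewrite leq_addl.
  exact: generated_rel_span (rel_span_le wr Rx).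
elim: w pos_w K {wr} => [|k w IH] pos_w K sK KW KR.
  by apply: (KW 0%N); exact: (@word_span_gen 0 0 [::]).
move: pos_w => /= /andP[k0 pos_w].
apply: (IH pos_w (fun x => K (X k.-1 x))) => [|c x Wx|x Rx].
- exact: subspace_preim.
- rewrite -Op_e (divp_eq (e F k.-1) P) OpDl.
  have [_ KD _] := sK; apply: KD.
    by apply: KR; rewrite mulrC; apply: rel_span_gen; exact: shorter_word_span Wx.
  apply: (KW c.+1); apply: word_span_Op => //.
  by rewrite -ltnS -(size_polyP F n) ltn_modp -size_poly_eq0 size_polyP.
- by rewrite -Op_e; apply: KR; exact: rel_span_Op.
Qed.

End Level.

End Filtration.
End Operators.

(** * Modes of vertex operators *)

Lemma perm_count_iota (w : seq nat) N : all (fun k => 0 < k <= N)%N w ->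
  perm_eq w (flatten [seq nseq (count_mem k w) k | k <- iota 1 N]).
Proof.
move=> /allP wN; apply/allP => x _ /=; apply/eqP.
rewrite count_flatten -map_comp sumnE big_map.
under eq_bigr do rewrite /= count_nseq.
have [xN|xN] := boolP (x \in iota 1 N).
  rewrite (bigD1_seq x) ?iota_uniq//= eqxx mul1n big1 ?addn0// => k kx.
  by rewrite (negPf kx).
rewrite big_seq big1 => [|k kN]; last first.
  by rewrite /=; case: (k =P x) => [kx|//]; move: xN; rewrite -kx kN.
by rewrite (count_memPn _)//; apply/negP => /wN xw; move: xN; rewrite mem_iota; lia.
Qed.

Lemma star_basisE (F : fieldType) n (v : V F) :
  star n (basis F [:: 1%N]) v =
  \sum_(m < n.+1) ((-1) ^+ m * ('C(m + n, n))%:R) *: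
    \sum_(j < (sumn [:: 1%N] + n).+1) 'C(sumn [:: 1%N] + n, j)%:R *:
      modeB [:: 1%N] (Negz (n + m) + j%:Z) v.
Proof.
have -> : star n (basis F [:: 1%N]) v = starP n (mkPart [:: 1%N]) v.
  by rewrite basisE; exact: (lin_part (fun p => starP n p v)).
have v1 : val (mkPart [:: 1%N]) = [:: 1%N] by rewrite val_mkPart.
rewrite /starP /modeP /pwt v1.
have idx (m j : nat) : j%:Z - n%:Z - m%:Z - 1 = Negz (n + m) + j%:Z by lia.
apply: eq_sum_scale => m; apply: eq_sum_scale => j.
by rewrite (idx m j).
Qed.

Section Modes.
Variable F : numFieldType.
Local Notation V := (V F).
Implicit Types (u v x y : V).

Definition creation k : {linear V -> V} := @X F k.
Local Notation lead := (lead creation).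
Local Notation leadz := (leadz creation).
Local Notation prod_coef := (prod_coef creation).
Local Notation Op := (Op creation).

Lemma creation_comm j k v : creation j (creation k v) = creation k (creation j v).
Proof. exact: X_comm. Qed.

Lemma shorter_creation d k v : shorter d v -> shorter d.+1 (creation k v).
Proof. exact: shorter_X. Qed.

Lemma shorter_scale d c v : shorter d v -> shorter d (c *: v).
Proof. by case: (shorter_subspace F d) => _ _; apply. Qed.

Lemma alpha_creation m v : (0 < m)%N -> alpha (- m%:Z) v = creation (m - 1) v.
Proof.
case: m => // m _; rewrite subn1 -NegzE -[RHS]/(X m v).
by rewrite X.unlock.
Qed.

Lemma modeB_nil q v : modeB [::] q v = leadz [::] q v.
Proof. by case: q => [|[|]]. Qed.

Lemma modeB_cons k w q v :
  modeB (k :: w) q v =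
  \sum_(i < (sumn (k :: w) + maxwt v + `|q|).+1) ('C(k + i - 1, i))%:R *:
    (alpha (- (k + i)%:Z) (modeB w (q + i%:Z) v)
     - (-1) ^+ k *: modeB w (q - k%:Z - i%:Z) (alpha i%:Z v)).
Proof. by []. Qed.

(** In the recursion for modes, the terms with alpha(i), i >= 0, first shorten v, so only products
    of creation operators reach the top length. *)
Lemma modeB_leading d w q v : positive w -> shorter d v ->
  shorter (d + size w).-1 (modeB w q v - leadz w q v).
Proof.
elim: w d q v => [|k w IH] d q v.
  by move=> _ _; rewrite modeB_nil subrr; case: (shorter_subspace F (d + 0).-1).
move=> /andP[k0 pos_w] Fv; rewrite [size _]/= addnS [_.-1]/=.
have modeF q' d' v' : shorter d' v' -> shorter (d' + size w) (modeB w q' v').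
  move=> Fv'; apply: (subspace_subr (shorter_subspace _ _) _
    (shorter_leadz (shorter_subspace F) shorter_creation w q' Fv')).
  by apply: shorter_le (IH _ q' _ pos_w Fv'); rewrite leq_pred.
have step m q' : shorter (d + size w) (creation m (modeB w q' v - leadz w q' v)).
  (* [(d + size w).-1.+1] is [d + size w] unless both d and w are trivial; hence the empty word is
     treated apart, its difference being zero. *)
  case: w IH pos_w {modeF} => [_ _|j w IH pos_w].
    by rewrite modeB_nil subrr linear0; case: (shorter_subspace F (d + 0)).
  rewrite [size _]/= addnS; apply: shorter_creation.
  by have := IH _ q' _ pos_w Fv; rewrite [size _]/= addnS.
rewrite modeB_cons (leadz_cons _ _ _ _ (leq_addl (sumn (k :: w) + maxwt v) `|q|%N)).
apply: (subspace_sumZB _ _ (shorter_subspace F _)) => i.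
apply: (subspaceBAC (shorter_subspace F (d + size w))); last first.
  have dw : (d.-1 + size w <= d + size w)%N by rewrite leq_add2r leq_pred.
  by apply: shorter_scale; apply: (shorter_le dw); apply: modeF; exact: shorter_annihilation.
rewrite alpha_creation ?addn_gt0 ?k0// -(linearB (creation (k + i - 1))).
exact: step.
Qed.

Lemma residue_leading d (N T : nat) w v : positive w -> shorter d v ->
  shorter (d + size w).-1
    (\sum_(j < (sumn w + N).+1) 'C(sumn w + N, j)%:R *: modeB w (Negz T + j%:Z) v
     - prod_coef [seq e F k.-1 | k <- w] N T v).
Proof.
move=> pos_w Fv; rewrite (prod_coef_leadz _ _ _ _ pos_w).
apply: (subspace_sumZB _ _ (shorter_subspace F _)) => j.
exact: modeB_leading.
Qed.

Lemma circE n (u : Part) v :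
  circ n u v = \sum_(j < (pwt u + n).+1)
    'C(pwt u + n, j)%:R *: modeB (val u) (Negz (2 * n).+1 + j%:Z) v.
Proof.
apply: eq_bigr => j _; congr (_ *: modeB _ _ _).
by rewrite -[2%R]/(Posz 2); lia.
Qed.

Lemma circ_leading d n (u : Part) v : shorter d v ->
  shorter (d + size (val u)).-1
    (circ n u v - prod_coef [seq e F k.-1 | k <- val u] n (2 * n).+1 v).
Proof.
move=> Fv; have := @residue_leading d n (2 * n).+1 _ v (positive_val u) Fv.
by rewrite circE.
Qed.

(** alpha(-1)1 corresponds to the polynomial 1 = [e 0], so [prod_coef1] turns the defining sum of
    the product into S term by term. *)
Lemma star_leading d n v : shorter d v ->
  shorter d (star n (basis F [:: 1%N]) v - Op (polyS F n) v).
Proof.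
move=> Fv; rewrite star_basisE /polyS Op_suml.
under [X in _ - X]eq_bigr do rewrite OpZl -[pshift _ _]mulr1 -(e0 F) -prod_coef1.
apply: (subspace_sumZB _ _ (shorter_subspace F _)) => m.
by have := @residue_leading d n (n + m) [:: 1%N] v isT Fv; rewrite addn1.
Qed.

Lemma basis_word w : positive w -> basis F w = word creation (basis F [::]) w.
Proof.
elim: w => // k w IH /andP[k0 pos_w].
by rewrite -[RHS]/(creation k.-1 (word creation (basis F [::]) w)) -IH// [RHS]X_bvec// prednK.
Qed.

End Modes.

(** * Generation of the level n Zhu algebra *)

Section Main.
Variables (F : numFieldType) (a : F) (n : nat).
Hypothesis n_gt0 : (0 < n)%N.
Local Notation V := (V F).
Local Notation S := (polyS F n).
Local Notation Op := (Op (@creation F)).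
Local Notation prod_coef := (prod_coef (@creation F)).
Local Notation vac := (basis F [::]).
Local Notation word := (word (@creation F) vac).
Implicit Types (u v x y : V).

Definition generator v :=
  (exists2 i : nat -> nat, (i 1%N <= n)%N & v = monom F (2 * n) i)
  \/ (exists2 j : nat, (0 < j)%N & v = bvec F (nseq j 1%N)).

Definition generated v := exists2 g, gen_by n generator g & On a n (v - g).

Lemma generated_subspace : subspace generated.
Proof.
split=> [|x y [g gg xg] [h gh yh]|c x [g gg xg]].
- by exists 0; [exact: gen_zero | rewrite subr0; exact: On_zero].
- exists (g + h); first exact: gen_add.
  by rewrite opprD addrACA; exact: On_add.
- by exists (c *: g); [exact: gen_scale | rewrite -scalerBr; exact: On_scale].
Qed.

Lemma generated_On v : On a n v -> generated v.
Proof. by exists 0; [exact: gen_zero | rewrite subr0]. Qed.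

Lemma generated_gen v : gen_by n generator v -> generated v.
Proof. by exists v => //; rewrite subrr; exact: On_zero. Qed.

Lemma shorter_vac : shorter 1 vac.
Proof. exact: shorter_bvec. Qed.

Section Level.
Variable r : nat.
Hypothesis low : forall v, shorter r v -> generated v.

(** The coefficient is the leading part of some u o_n v, which lies in O_n; the difference is
    shorter, hence generated by [low]. *)
Lemma generated_circ d w v : shorter d v -> ((d + size w).-1 <= r)%N ->
  generated (prod_coef [seq e F k | k <- w] n (2 * n).+1 v).
Proof.
move=> Fv dr; set u := mkPart (map succn w).
have pos_w : positive (map succn w) by apply/allP => _ /mapP[k _ ->].
have uw : perm_eq (val u) (map succn w) by apply: perm_val_mkPart.
have := @circ_leading _ d n u v Fv.
have -> : prod_coef [seq e F k.-1 | k <- val u] n (2 * n).+1 v =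
    prod_coef [seq e F k | k <- w] n (2 * n).+1 v.
  apply: (prod_coef_perm (@creation_comm F)).
  by rewrite (perm_trans (perm_map _ uw))// -map_comp.
rewrite (perm_size uw) size_map => /(shorter_le dr)/low Glow.
rewrite -(subKr (circ n u v) (prod_coef _ _ _ _)).
apply: (subspaceB generated_subspace _ Glow).
exact/generated_On/On_circ.
Qed.

(** Left multiplication by alpha(-1)1, a generator with j = 1, is [Op S] up to shorter terms; it is
    applied i times to a generator of the first family. *)
Lemma generated_star i w : letters n w -> (count_mem 1%N w <= n)%N ->
  (i + size w <= r)%N -> generated (iter i (Op S) (word w)).
Proof.
move=> w2n w1 iwr.
have pos_w : positive w by apply: sub_all w2n => k /andP[].
suff [g gg] : exists2 g, gen_by n generator g &
    shorter (i + size w) (iter i (Op S) (word w) - g).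
  move=> /(shorter_le iwr)/low Glow; apply: (subspace_subr generated_subspace Glow).
  exact: generated_gen.
elim: i {iwr} => [|i [g gg Fg]].
  exists (basis F w).
    apply: gen_base; left; exists (fun k => count_mem k w) => //.
    by rewrite /monom -basisE; apply/eq_bvec/perm_count_iota.
  rewrite [iter _ _ _]/= -basis_word// subrr.
  by case: (shorter_subspace F (0 + size w)).
exists (star n (basis F [:: 1%N]) g).
  by apply: gen_mul gg; apply: gen_base; right; exists 1%N; rewrite ?basisE.
have Fw : shorter (i + size w).+1 (iter i (Op S) (word w)).
  elim: i {g gg Fg} => [|i IH].
    by rewrite [iter _ _ _]/= -basis_word//; exact: shorter_bvec.
  rewrite iterS; exact: (shorter_Op (shorter_subspace F) (@shorter_creation F)).
have Fg' : shorter (i + size w).+1 g.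
  rewrite -(subKr (iter i (Op S) (word w)) g).
  apply: (subspaceB (shorter_subspace _ _) Fw).
  exact: shorter_le (leqnSn _) Fg.
(* Two errors remain: that of g, carried along by [Op S], and that of replacing [Op S g] by the star
   product. *)
rewrite iterS addSn -(subrKA (Op S g)).
have [_ FD _] := shorter_subspace F (i + size w).+1.
apply: FD.
  rewrite -linearB; exact: (shorter_Op (shorter_subspace F) (@shorter_creation F)).
rewrite -opprB -scaleN1r; apply: shorter_scale; exact: star_leading.
Qed.

Lemma generated_level v : shorter r.+1 v -> generated v.
Proof.
apply: (shorter_ind generated_subspace) => w pos_w wr; rewrite basis_word//.
by apply: (word_level (@creation_comm F) (shorter_subspace F) (@shorter_le F) (@shorter_creation F)
  shorter_vac n_gt0 generated_subspace generated_circ generated_star).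
Qed.

End Level.

Lemma all_generated v : generated v.
Proof.
have lev d x : shorter d x -> generated x.
  elim: d x => [|d IH] x; last exact: generated_level.
  by move=> /shorter_zero ->; case: generated_subspace.
suff Fv : shorter (\max_(p <- msupp v) size (val p)).+1 v by exact: lev Fv.
by move=> p pv; rewrite ltnS; exact: leq_bigmax_seq pv isT.
Qed.

End Main.

Theorem theorem6p8 (R : realType) (a : R[i]) (n : nat) (n_pos : (0 < n)%N) :
  zhu_generated a n
    (fun v : V R[i] =>
       (exists2 i : nat -> nat, (i 1%N <= n)%N & v = monom R[i] (2 * n) i)
       \/ (exists2 j : nat, (0 < j)%N & v = bvec R[i] (nseq j 1%N))).
Proof.
by move=> v; exact: all_generated.
Qed.
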